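(* If $1<k<n$, every homogeneous non-commutative arithmetic circuit computing \[ S_n^{k+1}(x_1,\dots,x_n)=\sum_{1\le i_1<\cdots<i_{k+1}\le n}\ \prod_{j=1}^{k+1}x_{i_j}\in\mathbb{F}\langle x_1,\dots,x_n\rangle \] (product taken in the order $j=1,\dots,k+1$) has non-scalar size $\Omega(k(n-k))$.
   Context: Let $\mathbb{F}$ be a field; variables do not commute multiplicatively. A non-commutative arithmetic circuit is a directed acyclic graph whose in-degree-zero nodes are labelled by variables or field elements, and whose other nodes have in-degree two and are labelled $+$ or $\times$, the two edges into a $\times$ gate being labelled left and right to indicate the order of multiplication. It computes $f$ if some gate computes $f$; it is homogeneous if every gate computes a homogeneous polynomial. A product gate is non-scalar if both its inputs compute non-constant polynomials; the non-scalar size is the number of such gates. *)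

(* Defs.v *)
From mathcomp Require Import all_boot all_order all_algebra.
From mathcomp Require Import finmap.
From mathcomp.multinomials Require Import monalg.

Set Implicit Arguments.
Unset Strict Implicit.
Unset Printing Implicit Defensive.

Import Order.TTheory GRing.Theory Num.Theory.
Local Open Scope ring_scope.

(* F<x_1, ..., x_n>: the algebra of the free monoid on 'I_n. The variables are
   indexed from 0. *)
Notation ncpoly F n := {malg F[{fmonom 'I_n}]}.

Definition ncvar (F : fieldType) (n : nat) (i : 'I_n) : ncpoly F n :=
  << fmu i >>.

Definition is_constant (F : fieldType) (n : nat) (p : ncpoly F n) : bool :=
  p == (p@_mone)%:MP.

Lemma is_constantP (F : fieldType) (n : nat) (p : ncpoly F n) :
  reflect (exists c : F, p = c%:MP) (is_constant p).
Proof.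
apply: (iffP eqP) => [->|[c ->]]; first by exists (p@_mone).
by rewrite malgCK.
Qed.

(* The zero polynomial is homogeneous (of every degree). *)
Definition homogeneous_poly (F : fieldType) (n : nat) (p : ncpoly F n) : Prop :=
  exists d : nat, forall m : {fmonom 'I_n}, m \in msupp p -> fdeg m = d.

(* The ordered elementary symmetric polynomial S_n^d. The product over 'I_d is
   taken in increasing order of the index. *)
Definition ordered_sym (F : fieldType) (n d : nat) : ncpoly F n :=
  \sum_(t : d.-tuple 'I_n | sorted (fun i j : 'I_n => (i < j)%N) t)
     \prod_(j < d) ncvar F (tnth t j).

(* The label of a node together with its in-edges; in Mul u v, u is the left
   factor and v the right one. The two in-edges may start at the same node. *)
Inductive gate (F : fieldType) (n : nat) (V : Type) : Type :=
  | Var of 'I_n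
  | Const of F
  | Add of V & V
  | Mul of V & V.

Definition gate_inputs (F : fieldType) (n : nat) (V : Type) (g : gate F n V) :
    seq V :=
  match g with
  | Var _ | Const _ => [::]
  | Add u v | Mul u v => [:: u; v]
  end.

Definition edge (F : fieldType) (n : nat) (V : finType)
    (g : V -> gate F n V) : rel V :=
  fun u v => u \in gate_inputs (g v).

Record circuit (F : fieldType) (n : nat) : Type := Circuit {
  node :> finType;
  gate_of : node -> gate F n node;
  circuit_acyclic :
    forall u v : node, edge gate_of u v -> ~~ connect (edge gate_of) v u
}.

Section Eval.

Variables (F : fieldType) (n : nat) (C : circuit F n).

Definition gate_value (val : C -> ncpoly F n) (g : gate F n C) : ncpoly F n :=
  match g with
  | Var i => ncvar F i
  | Const c => c%:MP
  | Add u v => val u + val v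
  | Mul u v => val u * val v
  end.

Fixpoint value_fuel (k : nat) (v : C) : ncpoly F n :=
  if k is k'.+1 then gate_value (value_fuel k') (gate_of v) else 0.

(* A path in the circuit has at most #|C| nodes, so this fuel is sufficient:
   see valueE and value_unique. *)
Definition value (v : C) : ncpoly F n := value_fuel #|C| v.

Let e : rel C := edge (@gate_of F n C).
Let rank (v : C) : nat := #|[set u | connect e u v]|.

Lemma eq_gate_value (f1 f2 : C -> ncpoly F n) (v : C) :
  (forall u, e u v -> f1 u = f2 u) ->
  gate_value f1 (gate_of v) = gate_value f2 (gate_of v).
Proof.
rewrite /e /edge; case: (gate_of v) => [i|c|u w|u w] /= eqf.
- by [].
- by [].
- by congr (_ + _); apply: eqf; rewrite !inE eqxx ?orbT.
- by congr (_ * _); apply: eqf; rewrite !inE eqxx ?orbT.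
Qed.

Lemma rank_edge (u v : C) : e u v -> (rank u < rank v)%N.
Proof.
move=> euv; apply: proper_card; apply/properP; split.
  by apply/subsetP=> w; rewrite !inE => /connect_trans; apply; apply: connect1.
by exists v; rewrite !inE ?connect0 //; apply: circuit_acyclic.
Qed.

Lemma value_fuel_stable (k1 k2 : nat) (v : C) :
  (rank v <= k1)%N -> (rank v <= k2)%N -> value_fuel k1 v = value_fuel k2 v.
Proof.
have rank_gt0 w : (0 < rank w)%N.
  by apply/card_gt0P; exists w; rewrite inE connect0.
elim: k1 k2 v => [|k1 IHk] k2 v; first by rewrite leqn0 eqn0Ngt rank_gt0.
case: k2 => [|k2] le1 le2; first by rewrite leqn0 eqn0Ngt rank_gt0 in le2.
apply: eq_gate_value => u /rank_edge ltuv.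
by apply: IHk; rewrite -ltnS; [apply: leq_trans le1 | apply: leq_trans le2].
Qed.

Lemma valueE (v : C) : value v = gate_value value (gate_of v).
Proof.
rewrite /value (@value_fuel_stable #|C| #|C|.+1) ?max_card //.
by rewrite (leq_trans (max_card _)).
Qed.

Lemma value_unique (f : C -> ncpoly F n) :
  (forall v, f v = gate_value f (gate_of v)) -> f =1 value.
Proof.
move=> fE v; have [k] := ubnP (rank v); elim: k v => // k IHk v ltvk.
rewrite fE valueE; apply: eq_gate_value => u /rank_edge ltuv.
by apply: IHk; apply: leq_trans ltuv _.
Qed.

Definition computes (f : ncpoly F n) : Prop := exists v : C, value v = f.

Definition homogeneous : Prop := forall v : C, homogeneous_poly (value v).

Definition is_nonscalar (v : C) : bool :=
  if gate_of v is Mul u w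
  then ~~ is_constant (value u) && ~~ is_constant (value w) else false.

Definition nonscalar_size : nat := #|[set v : C | is_nonscalar v]|.

End Eval.

(* Main.v *)
(* In a homogeneous circuit, look at two consecutive positions of the words of a
   polynomial and replace all the other letters by 1. This window of a product
   lies inside one of the two factors, up to a scalar, except for the single
   window which straddles the cut; hence the windows of all the polynomials
   computed by a circuit span a space of dimension at most its non-scalar size.
   Reverse-mode differentiation along leftmost factors gives the polynomials B_x
   in f = sum_x x B_x with at most one further product per non-scalar gate, so
   their windows span dimension at most 2s. For f = S_n^(k+1) the (n - k)(k - 1)
   nontrivial windows of the B_x are triangular, hence independent. *)
Require Import Defs.
From mathcomp Require Import all_boot all_order all_algebra.
From mathcomp Require Import finmap zify.
From mathcomp.multinomials Require Import monalg.

Set Implicit Arguments.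
Unset Strict Implicit.
Unset Printing Implicit Defensive.

Import Order.TTheory GRing.Theory Num.Theory.
Local Open Scope ring_scope.

(** * Sums over all words of a given length *)

Section WordSums.

Variables (R : comNzRingType) (I : finType).
Implicit Types (G H : seq I -> R) (d : nat).

(** Recursion on the length keeps words as plain sequences, so a sum over concatenations splits
    without casts between tuple types. *)
Fixpoint word_sum (d : nat) (G : seq I -> R) : R :=
  if d is d'.+1 then \sum_x word_sum d' (fun w => G (x :: w)) else G [::].

Lemma eq_word_sum d G H :
  (forall w, size w = d -> G w = H w) -> word_sum d G = word_sum d H.
Proof.
elim: d G H => [|d IH] G H eqGH /=; first exact: eqGH.
by apply: eq_bigr => x _; apply: IH => w sz; apply: eqGH; rewrite /= sz.
Qed.

Lemma word_sum0 d G : (forall w, size w = d -> G w = 0) -> word_sum d G = 0.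
Proof.
elim: d G => [|d IH] G G0 /=; first exact: G0.
by rewrite big1 // => x _; apply: IH => w sz; apply: G0; rewrite /= sz.
Qed.

Lemma word_sumD d G H :
  word_sum d (fun w => G w + H w) = word_sum d G + word_sum d H.
Proof.
elim: d G H => [|d IH] G H //=.
by rewrite -big_split; apply: eq_bigr => x _; apply: IH.
Qed.

Lemma word_sumZ d c G : word_sum d (fun w => c * G w) = c * word_sum d G.
Proof.
elim: d G => [|d IH] G //=.
by rewrite mulr_sumr; apply: eq_bigr => x _; apply: IH.
Qed.

Lemma word_sum_cat d1 d2 G :
  word_sum (d1 + d2) G =
  word_sum d1 (fun s => word_sum d2 (fun t => G (s ++ t))).
Proof.
elim: d1 G => [|d1 IH] G //=.
by apply: eq_bigr => x _; apply: IH.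
Qed.

End WordSums.

(** * Word coefficients, homogeneity, and windows of products *)

Section Windows.

Variables (F : fieldType) (n : nat).
Implicit Types (p q : ncpoly F n) (w : seq 'I_n).

Definition wcoef p w : F := p@_(FMonom w).

(** The zero polynomial has every degree, hence the nonvanishing hypotheses wherever degrees are
    compared. *)
Definition homog_deg (d : nat) p : Prop :=
  forall w, wcoef p w != 0 -> size w = d.

Lemma wcoefD p q w : wcoef (p + q) w = wcoef p w + wcoef q w.
Proof. exact: mcoeffD. Qed.

Lemma wcoefZ c p w : wcoef (c *: p) w = c * wcoef p w.
Proof. exact: mcoeffZ. Qed.

Lemma wcoefC (c : F) w : wcoef c%:MP w = c *+ (w == [::]).
Proof. by rewrite /wcoef mcoeffC fmP fm1. Qed.

Lemma wcoef_var i w : wcoef (ncvar F i) w = (w == [:: i])%:R.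
Proof. by rewrite /wcoef mcoeffU1 fmP fmU eq_sym. Qed.

Lemma wcoef_neq0 p : p != 0 -> exists w, wcoef p w != 0.
Proof.
move=> p0; have [E|[m mp]] := fset_0Vmem (msupp p).
  by case/eqP: p0; apply/malgP=> m; rewrite mcoeff0 mcoeff_outdom // E inE.
by exists m; rewrite /wcoef fmK mcoeff_neq0.
Qed.

Lemma homogeneous_poly_deg p : homogeneous_poly p -> exists d, homog_deg d p.
Proof.
by case=> d hd; exists d => w; rewrite /wcoef mcoeff_neq0 => /hd <-.
Qed.

Lemma homog_deg_coef0 d p w : homog_deg d p -> size w != d -> wcoef p w = 0.
Proof. by move=> hp; apply: contraNeq => /hp ->. Qed.

(** All words of [p] have length [d], so of all cuts of [w] only the one after [d] letters
    contributes. *)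
Lemma wcoefM d p q w : homog_deg d p ->
  wcoef (p * q) w = wcoef p (take d w) * wcoef q (drop d w).
Proof.
move=> hp; rewrite /wcoef mcoeffMl.
have term (m1 m2 : {fmonom 'I_n}) : p@_m1 * q@_m2 *+ (mmul m1 m2 == FMonom w)
    = if (m1 == FMonom (take d w)) && (m2 == FMonom (drop d w))
      then p@_m1 * q@_m2 else 0.
  have [E|E] := eqVneq (mmul m1 m2) (FMonom w); last first.
    case: ifP => // /andP[/eqP e1 /eqP e2].
    by case/eqP: E; apply/eqP; rewrite fmP fmM e1 e2 /= cat_take_drop.
  have [->|m1p] := eqVneq p@_m1 0; first by rewrite !mul0r mul0rn if_same.
  have sz1 : size m1 = d by apply: hp; rewrite /wcoef fmK.
  have Ew : w = m1 ++ m2 by rewrite -fmM E.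
  by rewrite !fmP /= Ew -sz1 take_size_cat // drop_size_cat // !eqxx.
under eq_bigr => m1 _ do under eq_bigr => m2 _ do rewrite term.
(* The sums run over supports, which may miss a half of [w]; its coefficient is then zero and the
   one-term formula still holds. *)
have sum1 (T : choiceType) (A : {fset T}) (a : T) (f : T -> F) :
    (a \notin A -> f a = 0) -> \sum_(x <- A) (if x == a then f x else 0) = f a.
  move=> fa; rewrite -big_mkcond /=; have [aA|/[dup] aA /fa ->] := boolP (a \in A).
    by rewrite -big_filter filter_pred1_uniq ?fset_uniq // big_seq1.
  by rewrite big_seq_cond big1 // => x /andP[xA /eqP xa]; rewrite -xa xA in aA.
rewrite (eq_bigr (fun m1 => if m1 == FMonom (take d w)
                            then p@_m1 * q@_(FMonom (drop d w)) else 0)).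
  by rewrite sum1 // => /mcoeff_outdom ->; rewrite mul0r.
move=> m1 _; case: eqVneq => _ /=; last by rewrite big1.
by rewrite sum1 // => /mcoeff_outdom ->; rewrite mulr0.
Qed.

Lemma wcoef_inj p q : wcoef p =1 wcoef q -> p = q.
Proof. by move=> pq; apply/malgP => m; rewrite -[m]fmK; apply: pq. Qed.

Lemma homog_deg_var i : homog_deg 1 (ncvar F i).
Proof.
by move=> w; rewrite wcoef_var; case: (eqVneq w) => [->//|_]; rewrite eqxx.
Qed.

Lemma homog_degD d p q :
  homog_deg d p -> homog_deg d q -> homog_deg d (p + q).
Proof.
move=> hp hq w; apply: contraNeq => ne.
by rewrite wcoefD (homog_deg_coef0 hp) ?(homog_deg_coef0 hq) ?addr0.
Qed.

Lemma homog_degZ d c p : homog_deg d p -> homog_deg d (c *: p).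
Proof.
move=> hp w; apply: contraNeq => ne.
by rewrite wcoefZ (homog_deg_coef0 hp) ?mulr0.
Qed.

Lemma homog_mulZC d c p q : homog_deg d p -> (c *: p) * q = p * (c *: q).
Proof.
move=> hp; apply: wcoef_inj => w; rewrite (wcoefM _ _ (homog_degZ (c := c) hp)).
by rewrite (wcoefM _ _ hp) !wcoefZ mulrCA mulrA.
Qed.

Lemma homog_degM d e p q :
  homog_deg d p -> homog_deg e q -> homog_deg (d + e) (p * q).
Proof.
move=> hp hq w; rewrite (wcoefM _ _ hp) mulf_eq0 negb_or => /andP[/hp sp /hq sq].
by rewrite -(cat_take_drop d w) size_cat sp sq.
Qed.

Lemma homog_deg_unique d e p :
  p != 0 -> homog_deg d p -> homog_deg e p -> d = e.
Proof. by move=> /wcoef_neq0[w wp] /(_ w wp) <- /(_ w wp). Qed.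

Lemma homog_deg0_constant p : homog_deg 0 p -> is_constant p.
Proof.
move=> hp; apply/is_constantP; exists (wcoef p [::]); apply: wcoef_inj => w.
rewrite wcoefC; case: eqVneq => [-> //|w0].
by rewrite (homog_deg_coef0 hp) ?size_eq0.
Qed.

Lemma constant_homog_deg0 p : is_constant p -> homog_deg 0 p.
Proof.
by move=> /is_constantP[c ->] w; rewrite wcoefC; case: (eqVneq w) => [->|_] //=; rewrite eqxx.
Qed.

Lemma nonconstant_neq0 p : ~~ is_constant p -> p != 0.
Proof.
by apply: contraNneq => ->; apply/is_constantP; exists 0; rewrite malgC0E.
Qed.

(** If [d] and [f] differed, [q] would have to cancel a word of [p]; then [e = d], and the nonzero
    sum would have degree [d] after all. *)
Lemma homog_degD_summand d e f p q :
  homog_deg d p -> homog_deg e q -> homog_deg f (p + q) ->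
  p != 0 -> p + q != 0 -> d = f.
Proof.
move=> hp hq hpq p0 pq0; apply/eqP/negP => /negP df.
have [w wp] := wcoef_neq0 p0.
have := homog_deg_coef0 (w := w) hpq; rewrite (hp w wp) => /(_ df) /eqP.
rewrite wcoefD addrC addr_eq0 => /eqP wq.
have ed : e = d by rewrite -(hp w wp) (hq w) // wq oppr_eq0.
case/eqP: df; apply: (homog_deg_unique pq0) => //.
by apply: homog_degD => //; rewrite -ed.
Qed.

(* The coefficient matrix of p at the positions i, i + 1 in words with r letters
   after them, all the other letters being replaced by 1. *)
Definition window (i r : nat) p : 'M[F]_n :=
  \matrix_(a, b) word_sum i (fun s => word_sum r (fun t =>
    wcoef p (s ++ a :: b :: t))).

Lemma windowD i r p q : window i r (p + q) = window i r p + window i r q.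
Proof.
apply/matrixP => a b; rewrite !mxE -word_sumD; apply: eq_word_sum => s _.
by rewrite -word_sumD; apply: eq_word_sum => t _; apply: wcoefD.
Qed.

Lemma windowZ i r c p : window i r (c *: p) = c *: window i r p.
Proof.
apply/matrixP => a b; rewrite !mxE -word_sumZ; apply: eq_word_sum => s _.
by rewrite -word_sumZ; apply: eq_word_sum => t _; apply: wcoefZ.
Qed.

Lemma window0 i r : window i r 0 = 0.
Proof. by rewrite -(scale0r (0 : ncpoly F n)) windowZ scale0r. Qed.

Lemma window_homog0 d i r p : homog_deg d p -> (i + r.+2 != d)%N ->
  window i r p = 0.
Proof.
move=> hp ne; apply/matrixP => a b; rewrite !mxE.
apply: word_sum0 => s ss; apply: word_sum0 => t st.
by apply: homog_deg_coef0 hp _; rewrite size_cat /= ss st.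
Qed.

Lemma window_constant i r p : is_constant p -> window i r p = 0.
Proof. by move=> /constant_homog_deg0/window_homog0->//; rewrite addnS. Qed.

(** Replacing the letters of [q] by 1 leaves a scalar: the sum of its coefficients at words of the
    remaining length. *)
Lemma windowM_left d i r p q : homog_deg d p -> (i.+2 <= d)%N ->
  exists c, window i r (p * q) = c *: window i (d - i.+2) p.
Proof.
move=> hp le_d; have [le_r|lt_r] := leqP (d - i.+2) r; last first.
  (* Too few letters follow the window for the word to reach length [d]. *)
  exists 0; rewrite scale0r; apply/matrixP => a b; rewrite !mxE.
  apply: word_sum0 => s ss; apply: word_sum0 => t st.
  rewrite (wcoefM _ _ hp) take_oversize ?size_cat /= ?ss ?st; last by lia.
  by rewrite (homog_deg_coef0 hp) ?mul0r // size_cat /= ss st; lia.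
exists (word_sum (r - (d - i.+2)) (wcoef q)).
apply/matrixP => a b; rewrite !mxE -word_sumZ; apply: eq_word_sum => s ss.
rewrite -{1}(subnKC le_r) word_sum_cat -word_sumZ; apply: eq_word_sum => t st.
rewrite mulrC -word_sumZ; apply: eq_word_sum => t' _.
have szd : size (s ++ [:: a, b & t]) = d by rewrite size_cat /= ss st; lia.
rewrite (wcoefM _ _ hp) -!cat_cons catA.
by rewrite take_size_cat // drop_size_cat.
Qed.

Lemma windowM_right d i r p q : homog_deg d p -> (d <= i)%N ->
  exists c, window i r (p * q) = c *: window (i - d) r q.
Proof.
move=> hp le_d; exists (word_sum d (wcoef p)).
apply/matrixP => a b; rewrite !mxE -{1}(subnKC le_d) word_sum_cat mulrC -word_sumZ.
apply: eq_word_sum => s ss; rewrite mulrC -word_sumZ.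
apply: eq_word_sum => s' ss'; rewrite -word_sumZ; apply: eq_word_sum => t st.
by rewrite (wcoefM _ _ hp) -catA take_size_cat // drop_size_cat.
Qed.

(* A window of a product either lies inside one factor, or is the unique one
   straddling the cut between the factors. *)
Lemma windowM_mem (U : {vspace 'M[F]_n}) d e p q i r :
  homog_deg d p -> homog_deg e q ->
  (forall j s, window j s p \in U) -> (forall j s, window j s q \in U) ->
  window d.-1 e.-1 (p * q) \in U -> window i r (p * q) \in U.
Proof.
move=> hp hq Up Uq Us.
have [le_d|] := leqP i.+2 d.
  by have [c ->] := windowM_left r q hp le_d; apply: memvZ.
have [le_d _|lt_d le_d] := leqP d i.
  by have [c ->] := windowM_right r q hp le_d; apply: memvZ.
(* Now [d = i + 1], so the window straddles the cut, and the total degree leaves only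
   [r = e - 1]. *)
have [deg|ne] := eqVneq (i + r.+2)%N (d + e)%N; last first.
  by rewrite (window_homog0 (homog_degM hp hq)) ?mem0v.
have [-> ->] : i = d.-1 /\ r = e.-1 by lia.
exact: Us.
Qed.

End Windows.

(** * Bookkeeping of sums for one differentiation step *)

Lemma sum_mul_if_eq (R : pzRingType) (T : finType) (P : pred T) (a : T -> R) v p :
  \sum_(u | P u) a u * (if u == v then p else 0) = if P v then a v * p else 0.
Proof.
case: ifPn => Pv.
  rewrite (bigD1 v) //= eqxx big1 ?addr0 // => u /andP[_ /negPf->].
  exact: mulr0.
rewrite big1 // => u; case: eqVneq => [->|_ _]; first by rewrite (negPf Pv).
exact: mulr0.
Qed.

Lemma sum_mulD (R : pzRingType) (T : finType) (P : pred T) (a b c : T -> R) :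
  \sum_(u | P u) a u * (b u + c u) =
  \sum_(u | P u) a u * b u + \sum_(u | P u) a u * c u.
Proof. by rewrite -big_split; apply: eq_bigr => u _; apply: mulrDr. Qed.

Lemma sum_mul0 (R : pzRingType) (T : finType) (P : pred T) (a : T -> R) :
  \sum_(u | P u) a u * 0 = 0.
Proof. by rewrite big1 // => u _; apply: mulr0. Qed.

(** The term of [v] is expanded and spread over the other nodes and the variables. *)
Lemma sum_push (R : pzRingType) (T I : finType) (D : {set T}) (P : pred T)
    (a A dA : T -> R) (y B dB : I -> R) v :
  v \in D -> P v ->
  a v * A v = \sum_(u in D :\ v | P u) a u * dA u + \sum_i y i * dB i ->
  \sum_(u in D | P u) a u * A u + \sum_i y i * B i =
  \sum_(u in D :\ v | P u) a u * (A u + dA u) + \sum_i y i * (B i + dB i).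
Proof.
move=> vD vP avE; rewrite (bigD1 v) /= ?vD // avE.
rewrite (eq_bigl (fun u => (u \in D :\ v) && P u)); last first.
  by move=> u; rewrite !inE andbC andbA.
by rewrite !sum_mulD -addrA addrACA; congr (_ + _); apply: addrC.
Qed.

(** * The space spanned by the windows of all gates *)

Section HomogeneousCircuit.

Variables (F : fieldType) (n : nat) (C : circuit F n) (deg : C -> nat).
Hypothesis degP : forall v : C, homog_deg (deg v) (value v).

(** Counting the nodes that reach [v], rather than measuring longest paths, makes this the measure
    of [rank_edge]. *)
Definition depth (v : C) : nat := #|[set u | connect (edge (@gate_of F n C)) u v]|.

(** The straddling window of a product: the only one that its inputs do not already provide. *)
Definition cut_window (v : C) : 'M[F]_n :=
  if gate_of v is Mul u w then window (deg u).-1 (deg w).-1 (value v) else 0.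

Definition gate_windows : {vspace 'M[F]_n} :=
  <<[seq cut_window v | v <- enum [set v : C | is_nonscalar v]]>>%VS.

Lemma dim_gate_windows : (\dim gate_windows <= nonscalar_size C)%N.
Proof.
by apply: leq_trans (dim_span _) _; rewrite size_map -cardE.
Qed.

(** By induction on depth: sums and products with a constant act linearly on windows, and a
    non-scalar product adds only its straddling window. *)
Lemma window_value_mem (v : C) i r : window i r (value v) \in gate_windows.
Proof.
have [m] := ubnP (depth v); elim: m v i r => // m IH v i r lt_vm.
have {}IH u j s : edge (@gate_of F n C) u v -> window j s (value u) \in gate_windows.
  by move=> /rank_edge lt_uv; apply: IH; apply: leq_trans lt_uv _.
have [nsv|] := boolP (is_nonscalar v).
  have cutU : cut_window v \in gate_windows.
    by apply/memv_span/map_f; rewrite mem_enum inE.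
  move: nsv cutU IH; rewrite valueE /is_nonscalar /cut_window /edge valueE.
  case: (gate_of v) => //= a b _ cutU IH.
  by apply: windowM_mem cutU => // j s; apply: IH; rewrite !inE eqxx ?orbT.
move: IH; rewrite /is_nonscalar /edge [value v]valueE.
case: (gate_of v) => [x|c|a b|a b] /= IH nsv.
- by rewrite (window_homog0 (@homog_deg_var _ _ x)) ?mem0v ?addnS.
- by rewrite window_constant ?mem0v //; apply/is_constantP; exists c.
- by rewrite windowD memvD // IH // !inE eqxx ?orbT.
have {}IHa j s : window j s (value a) \in gate_windows by rewrite IH // !inE eqxx.
have {}IHb j s : window j s (value b) \in gate_windows by rewrite IH // !inE eqxx orbT.
case/nandP: nsv => /negbNE/is_constantP[c E].
  by rewrite E mul_malgC windowZ memvZ.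
by rewrite E -[c%:MP]mulr1 mul_malgC -(homog_mulZC _ _ (@degP a)) mulr1 windowZ memvZ.
Qed.

(** * Reverse-mode differentiation along leftmost factors *)

Section Adjoints.

Variables (f : ncpoly F n) (d : nat).

(* Reverse mode restricted to the leftmost factors: [A v] collects what stands
   to the right of gate [v] when [v] is the leftmost factor of [f], and [B x]
   what stands to the right of the variable [x]. *)
Definition adjoints (E : {vspace 'M[F]_n}) (D : {set C})
    (A : C -> ncpoly F n) (B : 'I_n -> ncpoly F n) : Prop :=
  [/\ forall v, ~~ is_constant (value v) ->
        forall w, wcoef (A v) w != 0 -> (deg v + size w)%N = d,
      forall v i r, window i r (A v) \in E,
      forall x i r, window i r (B x) \in E
    & f = \sum_(v in D | ~~ is_constant (value v)) value v * A v
          + \sum_x ncvar F x * B x].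

(** Eliminates [v] in favour of the increments [dA] and [dB]; windows are additive, so it suffices
    that those of the increments lie in the larger space. *)
Lemma adjoints_push (E E' : {vspace 'M[F]_n}) (D : {set C}) A B v dA dB :
  adjoints E D A B -> v \in D -> ~~ is_constant (value v) -> (E <= E')%VS ->
  (forall u, ~~ is_constant (value u) ->
     forall w, wcoef (dA u) w != 0 -> (deg u + size w)%N = d) ->
  (forall u i r, window i r (dA u) \in E') ->
  (forall x i r, window i r (dB x) \in E') ->
  value v * A v =
    \sum_(u in D :\ v | ~~ is_constant (value u)) value u * dA u
    + \sum_x ncvar F x * dB x ->
  adjoints E' (D :\ v) (fun u => A u + dA u) (fun x => B x + dB x).
Proof.
move=> [Adeg AE BE fE] vD vnc sE dAdeg dAE dBE dE; split.
- move=> u unc w; rewrite wcoefD => ne.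
  have [A0|] := eqVneq (wcoef (A u) w) 0; last exact: Adeg.
  by apply: dAdeg => //; rewrite A0 add0r in ne.
- by move=> u i r; rewrite windowD memvD // (subvP sE).
- by move=> x i r; rewrite windowD memvD // (subvP sE).
rewrite fE; exact: sum_push.
Qed.

Lemma sum_value_at (D : {set C}) a (p : ncpoly F n) : a \in D ->
  \sum_(u in D | ~~ is_constant (value u)) value u * (if u == a then p else 0)
  = if is_constant (value a) then 0 else value a * p.
Proof. by move=> aD; rewrite sum_mul_if_eq aD; case: is_constant. Qed.

Lemma if_adjoint_deg (a : C) (p : ncpoly F n) :
  (~~ is_constant (value a) -> forall w, wcoef p w != 0 -> (deg a + size w)%N = d) ->
  forall u, ~~ is_constant (value u) ->
    forall w, wcoef (if u == a then p else 0) w != 0 -> (deg u + size w)%N = d.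
Proof.
move=> H u nu w; have [ua|_] := eqVneq u a; first by rewrite ua in nu *; apply: H.
by rewrite /wcoef mcoeff0 eqxx.
Qed.

(** A variable hands [A v] to [B], a sum hands it to both summands, and a product hands
    [value b * A v] to its left factor [a], or a multiple of [A v] to [b] when [a] is constant. Only
    a non-scalar gate can need a new dimension, for the straddling window of [value b * A v]. *)
Lemma adjoints_step (E : {vspace 'M[F]_n}) (D : {set C}) A B v :
  adjoints E D A B -> (gate_windows <= E)%VS -> v \in D ->
  (forall u, edge (@gate_of F n C) u v -> u \in D) ->
  exists E' A' B', [/\ adjoints E' (D :\ v) A' B', (E <= E')%VS
    & (\dim E' <= \dim E + is_nonscalar v)%N].
Proof.
move=> adj sGE vD inD; have [Adeg AE BE fE] := adj.
have {}inD u : edge (@gate_of F n C) u v -> u \in D :\ v.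
  move=> uv; rewrite !inE inD // andbT; apply: contraL uv => /eqP->.
  by apply/negP => /circuit_acyclic; rewrite connect0.
(* Constant gates are absent from the sum, so dropping one changes nothing. *)
have [vc|vnc] := boolP (is_constant (value v)).
  exists E, A, B; split; [ | exact: subvv | exact: leq_addr].
  split; [exact: Adeg | exact: AE | exact: BE | ].
  rewrite fE; congr (_ + _); apply: eq_bigl => u.
  by rewrite !inE; case: (eqVneq u v) => [->|]; rewrite ?vc ?andbF.
have if_window (E' : {vspace 'M[F]_n}) (b : bool) (p : ncpoly F n) i r :
    window i r p \in E' -> window i r (if b then p else 0) \in E'.
  by case: b; rewrite // window0 mem0v.
have wE (U : {vspace 'M[F]_n}) : (E <= U)%VS ->
    forall (u : C) i r, window i r (value u) \in U.
  move=> sEU u i r; have /subvP sGU := subv_trans sGE sEU.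
  exact: sGU _ (window_value_mem u i r).
have := vnc; have := @degP v; have := @valueE _ _ _ v.
move: inD; rewrite /edge /is_nonscalar; case: (gate_of v) => [x|c|a b|a b] /= inD vE dv.
- exists E, (fun u => A u + 0), (fun y => B y + if y == x then A v else 0).
  split; [ | exact: subvv | exact: leq_addr].
  apply: (adjoints_push adj vD vnc (subvv E)).
  + by move=> u _ w; rewrite /wcoef mcoeff0 eqxx.
  + by move=> *; rewrite window0 mem0v.
  + by move=> y i r; apply: if_window.
  by rewrite sum_mul0 add0r sum_mul_if_eq vE.
- by rewrite vE; case/is_constantP; exists c.
- have aD : a \in D :\ v by apply: inD; rewrite !inE eqxx.
  have bD : b \in D :\ v by apply: inD; rewrite !inE eqxx orbT.
  move=> nc; have v0 := nonconstant_neq0 nc.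
  have summand (u u' : C) : value v = value u + value u' -> value u != 0 ->
    deg u = deg v.
    move=> E0 u0; apply: (homog_degD_summand (@degP u) (@degP u')) => //; rewrite -E0 //.
  (* A nonzero constant summand would force degree 0 on the nonconstant sum; so the terms missing
     from the sum over nonconstant gates are zero. *)
  have cst0 (u u' : C) : value v = value u + value u' -> is_constant (value u) ->
    value u = 0.
    move=> /summand du cu; apply/eqP; apply: contraNT nc => u0.
    apply: homog_deg0_constant.
    rewrite -(homog_deg_unique u0 (@degP u) (constant_homog_deg0 cu)).
    by rewrite du.
  have vE' : value v = value b + value a by rewrite addrC.
  (* Two separate indicators, since both inputs may be the same gate. *)
  exists E, (fun u => A u + ((if u == a then A v else 0) + (if u == b then A v else 0))),
    (fun x => B x + 0).
  split; [ | exact: subvv | exact: leq_addr].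
  apply: (adjoints_push adj vD vnc (subvv E)).
  + move=> u uc w; rewrite wcoefD => ne.
    have [A0|A0] := eqVneq (wcoef (if u == a then A v else 0) w) 0; last first.
      apply: if_adjoint_deg A0 => // ac w' w'p.
      by rewrite (summand a b) ?nonconstant_neq0 //; apply: Adeg.
    move: ne; rewrite A0 add0r; apply: if_adjoint_deg => // bc w' w'p.
    by rewrite (summand b a) ?nonconstant_neq0 //; apply: Adeg.
  + by move=> u i r; rewrite windowD memvD // if_window.
  + by move=> *; rewrite window0 mem0v.
  rewrite [X in _ + X]sum_mul0 addr0.
  rewrite [RHS]sum_mulD [X in _ = X + _](sum_value_at _ aD).
  rewrite [X in _ = _ + X](sum_value_at _ bD) vE mulrDl.
  congr (_ + _); case: ifP => //.
    by move/(cst0 _ _ vE)->; rewrite mul0r.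
  by move/(cst0 _ _ vE')->; rewrite mul0r.
have aD : a \in D :\ v by apply: inD; rewrite !inE eqxx.
have bD : b \in D :\ v by apply: inD; rewrite !inE eqxx orbT.
move=> nc; have v0 := nonconstant_neq0 nc.
have [ac|anc] := boolP (is_constant (value a)) => /=.
  have /is_constantP[c cE] := ac; rewrite cE mul_malgC in vE.
  have bnc : ~~ is_constant (value b).
    apply: contra nc => /constant_homog_deg0 hb; apply: homog_deg0_constant.
    by rewrite vE; apply: homog_degZ.
  exists E, (fun u => A u + if u == b then c *: A v else 0), (fun x => B x + 0).
  split; [ | exact: subvv | exact: leq_addr].
  apply: (adjoints_push adj vD vnc (subvv E)).
  + apply: if_adjoint_deg => _ w; rewrite wcoefZ mulf_eq0 negb_or.
    move=> /andP[_] /(Adeg _ nc) <-.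
    congr (_ + _)%N; apply: (homog_deg_unique v0) => //.
    by rewrite vE; apply: homog_degZ.
  + by move=> u i r; apply: if_window; rewrite windowZ memvZ.
  + by move=> *; rewrite window0 mem0v.
  rewrite [X in _ + X]sum_mul0 addr0.
  rewrite [RHS](sum_value_at _ bD) (negPf bnc) vE.
  exact: homog_mulZC (@degP b).
have dvE : deg v = (deg a + deg b)%N.
  apply: (homog_deg_unique v0) => //; rewrite vE; exact: homog_degM.
have bAdeg w : wcoef (value b * A v) w != 0 -> (deg a + size w)%N = d.
  rewrite (wcoefM _ _ (@degP b)) mulf_eq0 negb_or => /andP[/degP sb /(Adeg _ nc)].
  by rewrite -[in size w](cat_take_drop (deg b) w) size_cat sb dvE addnA.
have push (E' : {vspace 'M[F]_n}) : (E <= E')%VS ->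
    (forall i r, window i r (value b * A v) \in E') ->
    exists A' B', adjoints E' (D :\ v) A' B'.
  move=> sE bAE.
  exists (fun u => A u + if u == a then value b * A v else 0), (fun x => B x + 0).
  apply: (adjoints_push adj vD vnc sE).
  - exact: if_adjoint_deg.
  - by move=> u i r; apply: if_window.
  - by move=> *; rewrite window0 mem0v.
  rewrite [X in _ + X]sum_mul0 addr0.
  by rewrite [RHS](sum_value_at _ aD) (negPf anc) vE; apply/esym/mulrA.
have [/is_constantP[c cE]|bnc] := boolP (is_constant (value b)).
  have [|A' [B' adj']] := push E (subvv E).
    by move=> i r; rewrite cE mul_malgC windowZ memvZ.
  by exists E, A', B'; split; [exact: adj' | exact: subvv | exact: leq_addr].
(* The words of [A v] have length [d - deg v], so [M] is the window straddling the cut between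
   [value b] and [A v]. *)
pose M := window (deg b).-1 (d - deg v).-1 (value b * A v).
have [|A' [B' adj']] := push (E + <[M]>)%VS (addvSl _ _).
  have Avdeg : homog_deg (d - deg v) (A v).
    by move=> w /(Adeg _ nc) <-; rewrite addKn.
  have sE' : (E <= E + <[M]>)%VS by apply: addvSl.
  move=> i r; apply: (windowM_mem i r (@degP b) Avdeg).
  - exact: wE.
  - by move=> j s; apply: (subvP sE').
  by apply: (subvP (addvSr E <[M]>)); apply: memv_line.
exists (E + <[M]>)%VS, A', B'; split; [exact: adj' | exact: addvSl | ].
by apply: leq_trans (dimv_add_leqif _ _) _; rewrite leq_add2l dim_vline leq_b1.
Qed.

(** A gate of maximal depth in [D] is an input of no gate of [D], so removing it keeps [D] closed
    under inputs. *)
Lemma adjoints_exhaust (E : {vspace 'M[F]_n}) (D : {set C}) A B :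
  adjoints E D A B -> (gate_windows <= E)%VS ->
  (forall u v, edge (@gate_of F n C) u v -> v \in D -> u \in D) ->
  exists E' A' B', adjoints E' set0 A' B' /\
    (\dim E' <= \dim E + #|[set v in D | is_nonscalar v]|)%N.
Proof.
have [m] := ubnP #|D|; elim: m E D A B => // m IH E D A B ltD adj sGE Dcl.
have [D0|[v0 v0D]] := set_0Vmem D.
  by exists E, A, B; split; [rewrite -D0 | apply: leq_addr].
have [v vD' vmax] := arg_maxnP depth v0D; have vD : v \in D := vD'.
have [|E1 [A1 [B1 [adj1 sE1 dE1]]]] := adjoints_step adj sGE vD.
  by move=> u /Dcl; apply.
have [||u w uw|E2 [A2 [B2 [adj2 dE2]]]] := IH _ _ _ _ _ adj1.
- by move: ltD; rewrite (cardsD1 v) vD add1n ltnS.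
- exact: subv_trans sE1.
- rewrite !inE => /andP[_ wD]; rewrite (Dcl _ _ uw wD) andbT.
  apply: contraTneq (rank_edge uw) => ->; rewrite -leqNgt; exact: vmax.
exists E2, A2, B2; split=> //; apply: leq_trans dE2 _.
apply: leq_trans (leq_add dE1 (leqnn _)) _; rewrite -addnA leq_add2l.
rewrite (cardsD1 v [set v in D | is_nonscalar v]) inE vD /= leq_add2l.
by apply/subset_leq_card/subsetP => u; rewrite !inE -andbA.
Qed.

End Adjoints.

(** Differentiation starts from cofactor 1 at [v]. The non-scalar size is paid twice: once for
    [gate_windows], once for the products made on the way. *)
Lemma window_left_quotients (v : C) : ~~ is_constant (value v) ->
  exists (E : {vspace 'M[F]_n}) (B : 'I_n -> ncpoly F n),
  [/\ (\dim E <= (nonscalar_size C).*2)%N,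
      forall x i r, window i r (B x) \in E
    & value v = \sum_x ncvar F x * B x].
Proof.
move=> vnc.
have [|//|//|E [A [B [[_ _ BE vE] dE]]]] :=
  @adjoints_exhaust (value v) (deg v) gate_windows setT
    (fun u => if u == v then 1 else 0) (fun=> 0).
  split=> [u _ w|u i r|x i r|].
  - case: (eqVneq u) => [->|_]; last by rewrite /wcoef mcoeff0 eqxx.
    rewrite /wcoef mcoeff1 fmP fm1 /=; case: (eqVneq w) => [->|_]; last by rewrite eqxx.
    by rewrite addn0.
  - case: eqVneq => _; last by rewrite window0 mem0v.
    by rewrite window_constant ?mem0v //; apply/is_constantP; exists 1.
  - by rewrite window0 mem0v.
  by rewrite sum_value_at ?inE // (negPf vnc) mulr1 [X in _ + X]sum_mul0 addr0.
exists E, B; split => //.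
  rewrite -addnn; apply: leq_trans dE (leq_add dim_gate_windows _).
  by apply/subset_leq_card/subsetP => u; rewrite !inE.
by rewrite vE big1 ?add0r // => u; rewrite inE.
Qed.

End HomogeneousCircuit.

(** * Independence of triangular families of matrices *)

(** In a vanishing combination take [p] of least [h] with nonzero coefficient: at the pivot of [p]
    another matrix can be nonzero only if its [h] is smaller still, so that entry is not
    cancelled. *)
Lemma triangular_dim (F : fieldType) m n (T : finType) (h : T -> nat)
    (V : T -> 'M[F]_(m, n)) (a : T -> 'I_m) (b : T -> 'I_n) (E : {vspace 'M[F]_(m, n)}) :
  (forall p, V p \in E) -> (forall p, V p (a p) (b p) != 0) ->
  (forall p q, V p (a q) (b q) != 0 -> p != q -> (h p < h q)%N) ->
  (#|T| <= \dim E)%N.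
Proof.
move=> VE Vd Vt.
pose X := [tuple V (enum_val i) | i < #|T|].
have sXE : (<<X>> <= E)%VS by apply/span_subvP => _ /mapP[i _ ->].
apply: leq_trans (dimvS sXE).
suff /eqP -> : free X by rewrite size_tuple.
apply/freeP => k kX i; apply/eqP; apply: contraT => ki.
pose c p := k (enum_rank p).
have cX : \sum_p c p *: V p = 0.
  rewrite -[RHS]kX (reindex _ (onW_bij _ (@enum_val_bij T))) /=; apply: eq_bigr => j _.
  by rewrite (nth_map j) ?size_enum_ord // nth_ord_enum /c enum_valK.
have c0 : c (enum_val i) != 0 by rewrite /c enum_valK.
have [p cp pmin] := @arg_minnP _ (enum_val i) (fun p => c p != 0) h c0.
have /matrixP/(_ (a p) (b p)) := cX.
rewrite summxE (bigD1 p) //= big1 => [|q qp].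
  by rewrite !mxE addr0 => /eqP; rewrite mulf_eq0 (negPf cp) (negPf (Vd p)).
rewrite mxE; apply/eqP; rewrite mulf_eq0; apply: contraT; rewrite negb_or.
by case/andP=> /pmin le_pq /Vt/(_ qp); rewrite ltnNge le_pq.
Qed.

(** * Counting increasing words *)

Section OrderedWords.

Variable n : nat.
Implicit Types (x y a b : 'I_n) (s t u : seq 'I_n).

Notation ltI := (fun i j : 'I_n => (i < j)%N).

Lemma path_ltI_size x s : path ltI x s -> (x + size s < n)%N.
Proof.
elim: s x => [|y s IH] x /=; first by rewrite addn0.
by move=> /andP[xy /IH]; lia.
Qed.

Lemma path_ltI_cat x s a u : path ltI x (s ++ a :: u) ->
  (x + size s < a)%N /\ path ltI a u.
Proof.
elim: s x => [|y s IH] x /= /andP[xy]; first by rewrite addn0.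
by move=> /IH[]; split=> //; lia.
Qed.

Variable R : comNzRingType.

(** Exactly [r] values lie above [x], so the only increasing continuation uses all of them. *)
Lemma word_sum_path_last x r : (x + r.+1 = n)%N ->
  word_sum r (fun t => (path ltI x t)%:R : R) = 1.
Proof.
elim: r x => [|r IH] x xr //=.
have x1n : (x.+1 < n)%N by lia.
rewrite (bigD1 (Ordinal x1n)) //= big1 => [|y yx].
  by rewrite addr0 ltnSn -[RHS](IH (Ordinal x1n)) //= ; lia.
apply: word_sum0 => w sw; case: (boolP (_ && _)) => // /andP[xy /path_ltI_size].
rewrite sw => lt; exfalso; move: yx; rewrite -val_eqE /=; lia.
Qed.

(** Exactly [j] values lie strictly between [x] and [a], so the letters before [a] are forced. *)
Lemma word_sum_path_first x j a u : (x + j.+1 = a)%N ->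
  word_sum j (fun s => (path ltI x (s ++ a :: u))%:R : R) = (path ltI a u)%:R.
Proof.
elim: j x => [|j IH] x xj /=.
  by rewrite -xj addn1 ltnSn.
have x1n : (x.+1 < n)%N by have := ltn_ord a; lia.
rewrite (bigD1 (Ordinal x1n)) //= big1 => [|y yx].
  by rewrite addr0 ltnSn -[RHS](IH (Ordinal x1n)) //=; lia.
apply: word_sum0 => w sw; case: (boolP (_ && _)) => // /andP[xy /path_ltI_cat[]].
rewrite sw => lt _; exfalso; move: yx; rewrite -val_eqE /=; lia.
Qed.

End OrderedWords.

(** * Windows of the left quotients of the ordered symmetric polynomial *)

Section OrderedSym.

Variables (F : fieldType) (n : nat).

Lemma wcoef_sum (I : finType) (P : pred I) (p : I -> ncpoly F n) w :
  wcoef (\sum_(i | P i) p i) w = \sum_(i | P i) wcoef (p i) w.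
Proof. exact: raddf_sum. Qed.

Lemma wcoef_prod_var (s w : seq 'I_n) :
  wcoef (\prod_(x <- s) ncvar F x) w = (w == s)%:R.
Proof.
elim: s w => [|x s IH] w; first by rewrite big_nil wcoefC.
rewrite big_cons (wcoefM _ _ (@homog_deg_var _ _ x)) wcoef_var IH -natrM mulnb.
by case: w => [|y w] //=; rewrite take0 drop0 !eqseq_cons andbT.
Qed.

Lemma wcoef_ordered_sym d (w : seq 'I_n) :
  wcoef (ordered_sym F n d) w =
  ((size w == d) && sorted (fun i j : 'I_n => (i < j)%N) w)%:R.
Proof.
rewrite /ordered_sym wcoef_sum.
under eq_bigr => t _ do rewrite -(big_tuple _ _ t xpredT (ncvar F (n:=n))) wcoef_prod_var.
case: eqP => [sz|sz] /=; last first.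
  by rewrite big1 // => t _; case: eqP => // wt; case: sz; rewrite wt size_tuple.
have [tw Etw] : {t : d.-tuple 'I_n | tval t = w} by exists (Tuple (introT eqP sz)).
rewrite -Etw; case: (boolP (sorted _ tw)) => stw.
  rewrite (bigD1 tw) //= eqxx big1 ?addr0 // => t /andP[_ ne].
  by rewrite val_eqE eq_sym (negPf ne).
rewrite big1 // => t st; rewrite val_eqE; case: eqP => // E.
by rewrite -E (negPf stw) in st.
Qed.

(** Splitting off the first letter is unique, so every [B] extracted from a circuit has known
    coefficients. *)
Lemma wcoef_left_quotient (B : 'I_n -> ncpoly F n) x w :
  wcoef (\sum_y ncvar F y * B y) (x :: w) = wcoef (B x) w.
Proof.
rewrite wcoef_sum (bigD1 x) //= big1 => [|y yx];
  rewrite (wcoefM _ _ (@homog_deg_var _ _ _)) wcoef_var /= take0 drop0.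
  by rewrite eqxx mul1r addr0.
by rewrite eqseq_cons eq_sym (negPf yx) mul0r.
Qed.

(* Against the pivot of the pair (i, j), at row i + j + 1 and column n - k + 1 + j,
   the windows of the left quotients of S_n^(k+1) are triangular. *)
Lemma ordered_sym_window_dim k (B : 'I_n -> ncpoly F n) (E : {vspace 'M[F]_n}) :
  (1 < k)%N -> (k < n)%N ->
  ordered_sym F n k.+1 = \sum_x ncvar F x * B x ->
  (forall x i r, window i r (B x) \in E) ->
  ((n - k) * k.-1 <= \dim E)%N.
Proof.
move=> k1 kn SE BE.
have Bcoef x w : wcoef (B x) w =
    ((size w == k) && path (fun i j : 'I_n => (i < j)%N) x w)%:R.
  by rewrite -wcoef_left_quotient -SE wcoef_ordered_sym.
pose T := ('I_(n - k) * 'I_k.-1)%type.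
have xP (p : T) : (p.1 < n)%N by case: p => [[i] ? j] /=; lia.
have aP (p : T) : (p.1 + p.2.+1 < n)%N by case: p => [[i] ? [j] ?] /=; lia.
have bP (p : T) : (n - k + p.2.+1 < n)%N by case: p => [i [j] ?] /=; lia.
(* After the first letter [i], the [j] letters before the window exactly fill the gap up to row
   [i + j + 1], and the [k - j - 2] letters after it exactly fill the values above the column. One
   word remains, so the pivot is 1. *)
pose x p := Ordinal (xP p); pose a p := Ordinal (aP p); pose b p := Ordinal (bP p).
pose r (p : T) := (k - p.2.+2)%N.
pose V (p : T) := window p.2 (r p) (B (x p)).
have Vcoef (p q : T) : V p (a q) (b q) = word_sum p.2 (fun s => word_sum (r p) (fun t =>
    (path (fun i j : 'I_n => (i < j)%N) (x p) (s ++ a q :: b q :: t))%:R)).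
  rewrite mxE; apply: eq_word_sum => s ss; apply: eq_word_sum => t st.
  rewrite Bcoef size_cat /= ss st /r; case: p {ss st} => [i [j] /= ?].
  by rewrite (_ : (_ == k)%N = true) //; lia.
have -> : ((n - k) * k.-1)%N = #|{: T}| by rewrite card_prod !card_ord.
apply: (@triangular_dim _ _ _ _ (fun p : T => nat_of_ord p.1) V a b) => [p|p|p q].
- exact: BE.
- suff -> : V p (a p) (b p) = 1 by apply: oner_neq0.
  rewrite Vcoef.
  have brn : (b p + (r p).+1 = n)%N.
    by rewrite /= /r; case: p => [i [j] ?] /=; lia.
  have xa : (x p + p.2.+1 = a p)%N by [].
  have ab : (a p < b p)%N by rewrite /= ltn_add2r ltn_ord.
  transitivity ((path (fun i j : 'I_n => (i < j)%N) (a p) [:: b p])%:R : F).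
    rewrite -(word_sum_path_first _ _ xa); apply: eq_word_sum => s _.
    rewrite -[RHS]mulr1 -[X in _ = _ * X](word_sum_path_last F brn) -word_sumZ.
    apply: eq_word_sum => t _; rewrite -natrM mulnb.
    have -> : s ++ [:: a p, b p & t] = (s ++ [:: a p; b p]) ++ t by rewrite -catA.
    by rewrite [in LHS]cat_path [last _ _]last_cat.
  by rewrite /path ab.
move=> Vpq pq.
(* A nonzero entry needs room for the letters before and after the window, which gives these two
   inequalities. They imply [p.1 <= q.1], with equality only if [p = q]. *)
have [/andP[a_ge b_le]|ne] := boolP ((p.1 + p.2 <= q.1 + q.2) && (q.2 <= p.2))%N.
  rewrite ltnNge; apply: contra pq => le; apply/eqP.
  case: p q a_ge b_le le {Vpq} => [i j] [i' j'] /= a_ge b_le le.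
  by congr pair; apply: val_inj => /=; lia.
case/eqP: Vpq; rewrite Vcoef; apply: word_sum0 => s ss; apply: word_sum0 => t st.
case: (boolP (path _ _ _)) => // /path_ltI_cat[/=]; rewrite ss => a_gt.
move=> /andP[_ /path_ltI_size /=]; rewrite st /r => b_lt; case/negP: ne; move: a_gt b_lt.
case: p q {Vcoef ss st pq} => [[i] ? [j] ?] [[i'] ? [j'] ?] /=; lia.
Qed.

End OrderedSym.

(** * Assembling the lower bound *)

Theorem theorem4p8 :
  exists c : rat, 0 < c /\
    forall (F : fieldType) (n k : nat) (C : circuit F n),
      (1 < k)%N -> (k < n)%N ->
      homogeneous C ->
      computes C (ordered_sym F n k.+1) ->
      c * (k * (n - k))%:R <= (nonscalar_size C)%:R.
Proof.
(* One factor 2 comes from [(n - k) * (k - 1) <= 2 * s], with [s] the non-scalar size, the other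
   from [k <= 2 * (k - 1)]. *)
exists 4%:R^-1; split; first by rewrite invr_gt0 ltr0n.
move=> F n k C k1 kn homC [v vE].
have [deg degP] : exists deg : C -> nat, forall u : C, homog_deg (deg u) (value u).
  apply: (@fin_all_exists C (fun=> nat) (fun u d => homog_deg d (value u))) => u.
  exact: homogeneous_poly_deg.
(* As [k + 1 <= n], the first [k + 1] variables in order form a word of the target, which is
   therefore not constant. *)
have w0 : exists2 w : seq 'I_n, wcoef (value v) w != 0 & size w = k.+1.
  exists (take k.+1 (enum 'I_n)); last by rewrite size_takel // size_enum_ord.
  rewrite vE wcoef_ordered_sym size_takel ?size_enum_ord // eqxx.
  have -> : sorted (fun i j : 'I_n => (i < j)%N) (take k.+1 (enum 'I_n)).
    rewrite -[sorted _ _]/(sorted (relpre (@nat_of_ord n) ltn) _) -sorted_map.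
    rewrite map_take val_enum_ord take_iota.
    exact: iota_ltn_sorted.
  exact: oner_neq0.
have vnc : ~~ is_constant (value v).
  by case: w0 => w wv sw; apply/negP => /constant_homog_deg0/(_ _ wv); rewrite sw.
have [E [B [dE BE vB]]] := window_left_quotients degP vnc.
have := leq_trans (ordered_sym_window_dim k1 kn (etrans (esym vE) vB) BE) dE.
move=> le; rewrite ler_pdivrMl // -natrM ler_nat.
move: le; nia.
Qed.
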